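(* For every even integer $T\ge 2$, the iterates generated by the online two-point direct search described in the context satisfy $$\frac{1}{\sqrt{2\pi p}}\sum_{t\in[T]_2}\delta_t\,\mathbb{E}\big[\|\nabla\Phi_t(u_t)\|\big]\le \Phi_0(u_0)-\Phi_{\mathrm{low}}+\frac{L}{4}\sum_{t\in[T]_2}\delta_t^2+2D_T+2B_T .$$ Consequently, $$\min_{t\in[T]_2}\mathbb{E}\big[\|\nabla\Phi_t(u_t)\|\big]\le\frac{\sqrt{2\pi p}}{\sum_{t\in[T]_2}\delta_t}\Big[\Phi_0(u_0)-\Phi_{\mathrm{low}}+\frac{L}{4}\sum_{t\in[T]_2}\delta_t^2+2D_T+2B_T\Big].$$
   Context: $\mathbb{N}=\{0,1,2,\dots\}$, $p\ge1$ is an integer, and $\|\cdot\|$ is the Euclidean norm. For even $T\ge2$, $[T]_2=\{0,2,\dots,T-2\}$. Objectives: for each $t\in\mathbb{N}$, $\Phi_t:\mathbb{R}^p\to\mathbb{R}$ is differentiable with $L$-Lipschitz continuous gradient (same constant $L>0$ for all $t$), and $\Phi_t(u)\ge\Phi_{\mathrm{low}}$ for all $u$ and $t$, with $\Phi_{\mathrm{low}}\in\mathbb{R}$. Inexact oracle: for each $t$, $\tilde\Phi_t:\mathbb{R}^p\to\mathbb{R}$ is a (deterministic) continuous function. Temporal drift: $d_t=\sup_{u\in\mathbb{R}^p}|\Phi_{t+1}(u)-\Phi_t(u)|$, assumed finite for all $t$, and $D_T=\sum_{t=0}^{T-1}d_t$. Oracle error: $b_t=\sup_{u\in\mathbb{R}^p}|\tilde\Phi_t(u)-\Phi_t(u)|$,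 assumed finite for all $t$, and $B_T=\sum_{t=0}^{T-1}b_t$. Online two-point direct search: given a deterministic $u_0\in\mathbb{R}^p$ and a deterministic sequence of positive probing ratios $\delta_t$, for $t=0,2,4,\dots$: draw $v_t\sim\mathcal{N}(0,\frac1pI_p)$ independently of all previous draws, set $u_{t+1}=u_t+\delta_tv_t$, and set $u_{t+2}=u_{t+1}$ if $\tilde\Phi_{t+1}(u_{t+1})\le\tilde\Phi_t(u_t)$, and $u_{t+2}=u_t$ otherwise. $\mathbb{E}$ is expectation over the random directions. *)

(* Defs.v *)
From mathcomp Require Import all_boot all_order all_algebra.
From mathcomp Require Import all_classical all_reals all_analysis.

Set Implicit Arguments.
Unset Strict Implicit.
Unset Printing Implicit Defensive.

Import Order.TTheory GRing.Theory Num.Theory.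
Import numFieldNormedType.Exports.

Local Open Scope classical_set_scope.
Local Open Scope ring_scope.

(* Vectors of R^p are row vectors ['rV[R]_p]. Their library topology (hence
   [continuous] and [differentiable]) is the usual one, but the library norm on
   them is the sup norm, so the Euclidean norm has to be introduced. *)
Definition enorm (R : realType) (p : nat) (x : 'rV[R]_p) : R :=
  Num.sqrt (\sum_(i < p) x ord0 i ^+ 2).

Definition gradient (R : realType) (p : nat) (f : 'rV[R]_p -> R)
    (x : 'rV[R]_p) : 'rV[R]_p :=
  \row_(i < p) 'D_(delta_mx ord0 i) f x.

Definition lipschitz_gradient (R : realType) (p : nat) (L : R)
    (f : 'rV[R]_p -> R) : Prop :=
  forall x y, enorm (gradient f x - gradient f y) <= L * enorm (x - y).

(* Valued in \bar R: finiteness is a hypothesis of the theorem. *)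
Definition sup_dist (R : realType) (p : nat) (f g : 'rV[R]_p -> R) : \bar R :=
  ereal_sup (range (fun u => (`|f u - g u|)%:E)).

Definition borel (R : realType) (p : nat) : set_system 'rV[R]_p :=
  <<s [set A : set 'rV[R]_p | open A] >>.

Definition random_vector d (Omega : measurableType d) (R : realType) (p : nat)
    (V : Omega -> 'rV[R]_p) : Prop :=
  forall A, borel A -> measurable (V @^-1` A).

(* V has law N(0, s^2 I_p), that is, the p-fold product of N(0, s^2);
   the second parameter of [normal_prob] is the standard deviation. *)
Definition isotropic_gaussian d (Omega : measurableType d) (R : realType)
    (P : probability Omega R) (p : nat) (s : R)
    (V : Omega -> 'rV[R]_p) : Prop :=
  random_vector V /\
  forall A : 'I_p -> set R, (forall i, measurable (A i)) ->
    P [set w | forall i, A i (V w ord0 i)] =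
    (\prod_(i < p) normal_prob 0 s (A i))%E.

(* The sigma-algebra generated by the directions drawn before time t; only
   even times carry a draw. *)
Definition past_draws d (Omega : measurableType d) (R : realType) (p : nat)
    (v : nat -> Omega -> 'rV[R]_p) (t : nat) : set_system Omega :=
  <<s [set B | exists s A,
        [/\ (s < t)%N, ~~ odd s, borel A & B = v s @^-1` A] ] >>.

Definition independent_of_past d (Omega : measurableType d) (R : realType)
    (P : probability Omega R) (p : nat) (v : nat -> Omega -> 'rV[R]_p)
    (t : nat) : Prop :=
  forall A B, borel A -> past_draws v t B ->
    P ((v t @^-1` A) `&` B) = (P (v t @^-1` A) * P B)%E.

Definition gaussian_directions d (Omega : measurableType d) (R : realType)
    (P : probability Omega R) (p : nat) (v : nat -> Omega -> 'rV[R]_p) : Prop :=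
  forall t, ~~ odd t ->
    isotropic_gaussian P (Num.sqrt p%:R^-1) (v t) /\ independent_of_past P v t.

Record two_point_direct_search (Omega : Type) (R : realType) (p : nat)
    (oracle : nat -> 'rV[R]_p -> R) (u0 : 'rV[R]_p) (delta : nat -> R)
    (v u : nat -> Omega -> 'rV[R]_p) : Prop := {
  search_init : forall w, u 0%N w = u0 ;
  search_probe : forall t w, ~~ odd t -> u t.+1 w = u t w + delta t *: v t w ;
  search_select : forall t w, ~~ odd t ->
    u t.+2 w = if oracle t.+1 (u t.+1 w) <= oracle t (u t w)
               then u t.+1 w else u t w }.

(* Main.v *)
Require Import Defs.
From HB Require Import structures.
From mathcomp Require Import all_boot all_order all_algebra.
From mathcomp Require Import all_classical all_reals all_analysis.
From mathcomp Require Import measurable_realfun charge ring lra.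
Import Order.TTheory GRing.Theory Num.Theory.
Import numFieldNormedType.Exports.
Local Open Scope classical_set_scope.
Local Open Scope ring_scope.
Set Implicit Arguments.
Unset Strict Implicit.
Unset Printing Implicit Defensive.

(** Let [decrease f a x v] be the amount, nonnegative by definition, by which the
    probe [x + a *: v] lowers [f] when it is kept exactly if it helps. At an even
    time t the search compares oracle values taken at two different times, but
    each of them is within one oracle error and one drift of Phi_t, so that
      Phi_{t+2}(u_{t+2}) + decrease Phi_t delta_t u_t v_t
        <= Phi_t(u_t) + 2 (d_t + d_{t+1}) + 2 (b_t + b_{t+1})
    holds for every outcome ([search_step_decrease]). Summing over t bounds the
    total expected decrease by Phi_0(u_0) - Philow + 2 D_T + 2 B_T, and it remains
    to bound each expected decrease from below by the gradient.

    Fix x and let V be one gaussian direction, g the gradient of f at x. By the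
    descent lemma, f (x + a v) exceeds f x + a <g, v> by at most L a^2 |v|^2 / 2.
    Among v and -v, one makes the linear term equal to - a |<g, v>|; adding the
    two decreases gives
      a |<g, v>| <= decrease f a x v + decrease f a x (- v) + L a^2 |v|^2 / 2
    ([inner_le_decrease]). As V and -V have the same law, taking expectations
    yields E decrease >= a E|<g, V>| / 2 - L a^2 E|V|^2 / 4. Finally <g, V> is a
    centred normal variable of deviation |g| / sqrt p, so that
    E|<g, V>| = 2 |g| / sqrt (2 pi p), and E|V|^2 <= 1 ([expected_decrease]).
    The point x may be replaced by u_t because u_t is a function of earlier draws
    ([search_iterate_past]), hence independent of v_t ([ge0_expectation_indep]).

    The gaussian facts are derived from the definition of the law of V by its
    values on boxes. That law is symmetric since boxes generate the Borel sets
    ([ge0_expectation_gaussian_opp]); the law of <g, V> comes from the stability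
    of the normal law under independent sums, proved by completing the square
    ([gaussian_convolution], [gaussian_combination_law]). *)

(** * One-dimensional normal laws *)

(** The measure structure of a pushforward depends on a proof of measurability of
    the map, which inference does not find; it is an argument here. *)
Definition image_measure d1 d2 (T1 : measurableType d1) (T2 : measurableType d2)
    (R : realType) (m : {measure set T1 -> \bar R}) (f : T1 -> T2)
    (mf : measurable_fun setT f) : {measure set T2 -> \bar R} :=
  measure_function_pushforward__canonical__measure_function_Measure m mf.

Lemma probability_integral_cst d (Omega : measurableType d) (R : realType)
  (P : probability Omega R) (r : \bar R) : (\int[P]_w r = r)%E.
Proof.
rewrite integral_cst// [X in (_ * X)%E](_ : _ = 1%E) ?mule1//.
exact: probability_setT.
Qed.

(** The density agrees almost everywhere with the Radon-Nikodym derivative of the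
    normal law, for which the change of variables is known. *)
Lemma ge0_integral_normal_prob (R : realType) (m s : R) (f : R -> \bar R) :
  measurable_fun setT f -> (forall x, 0 <= f x)%E ->
  (\int[normal_prob m s]_x f x =
   \int[@lebesgue_measure R]_x (f x * (normal_pdf m s x)%:E))%E.
Proof.
move=> mf f0.
have dom : normal_prob m s `<< @lebesgue_measure R := normal_prob_dominates m s.
rewrite -(Radon_Nikodym_SigmaFinite.change_of_variables dom)//.
have mRN := measurable_int _ (Radon_Nikodym_SigmaFinite.f_integrable dom).
have mpdf : measurable_fun setT (fun x => (normal_pdf m s x)%:E).
  by apply/measurable_EFinP; exact: measurable_normal_pdf.
apply: ae_eq_integral => //.
- exact: emeasurable_funM.
- exact: emeasurable_funM.
apply: ae_eqe_mul2l; apply: integral_ae_eq => //.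
- exact: Radon_Nikodym_SigmaFinite.f_integrable.
- by move=> A _ mA; rewrite -Radon_Nikodym_SigmaFinite.f_integral.
Qed.

(** The scaled image of Lebesgue measure under the affine map gives half-open
    intervals their length, hence is Lebesgue measure. Substitution by the fundamental
    theorem of calculus would restrict [f] to continuous functions, whereas [f] will be an
    arbitrary indicator function in [gaussian_combination_law]. *)
Lemma ge0_integral_lebesgue_affine (R : realType) (a b : R) (f : R -> \bar R) :
  0 < a -> measurable_fun setT f -> (forall x, 0 <= f x)%E ->
  (a%:E * \int[@lebesgue_measure R]_x f (a * x + b)%R =
   \int[@lebesgue_measure R]_x f x)%E.
Proof.
move=> a0 mf f0.
pose phi := fun x : measurableTypeR R => (a * x + b) : measurableTypeR R.
have mphi : measurable_fun setT phi.
  by apply: measurable_funD => //; exact: measurable_funM.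
pose m := image_measure (@lebesgue_measure R) mphi.
have mE A : measurable A ->
   @lebesgue_measure R A = mscale (NngNum (ltW a0)) m A.
  move=> mA; apply: lebesgue_measure_unique => // _ [[x y] _ <-].
  have phiE : phi @^-1` `]x, y]%classic = `](x - b) / a, (y - b) / a]%classic.
    by apply/seteqP; split => z;
      rewrite /phi /= !in_itv/= ltr_pdivrMr// ler_pdivlMr// ltrBlDr lerBrDr mulrC.
  transitivity (a%:E *
      @lebesgue_measure R `](x - b) / a, (y - b) / a]%classic%R)%E; last first.
    by rewrite -phiE.
  rewrite !lebesgue_measure_itv/= !lte_fin ltr_pM2r ?invr_gt0// ltrD2r.
  case: ifPn => _; last by rewrite mule0.
  by rewrite -!EFinD -EFinM; congr EFin; field; rewrite gt_eqF.
transitivity (\int[mscale (NngNum (ltW a0)) m]_x f x)%E.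
  rewrite ge0_integral_mscale//; congr (_ * _)%E.
  by rewrite ge0_integral_pushforward.
by apply: eq_measure_integral => A mA _; exact/esym/mE.
Qed.

Lemma ge0_integral_lebesgue_opp (R : realType) (f : R -> \bar R) :
  measurable_fun setT f -> (forall x, 0 <= f x)%E ->
  (\int[@lebesgue_measure R]_x f (- x)%R = \int[@lebesgue_measure R]_x f x)%E.
Proof.
move=> mf f0.
pose phi := fun x : measurableTypeR R => - x : measurableTypeR R.
have mphi : measurable_fun setT phi by exact: measurable_funN.
pose m := image_measure (@lebesgue_measure R) mphi.
transitivity (\int[m]_x f x)%E.
  by rewrite ge0_integral_pushforward.
by apply: eq_measure_integral => A mA _; exact: lebesgue_measureN.
Qed.

Lemma normal_pdf_expE (R : realType) (m s x : R) : s != 0 ->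
  normal_pdf m s x = normal_peak s * expR (- (x - m) ^+ 2 / (s ^+ 2 *+ 2)).
Proof. by move=> s0; rewrite normal_pdfE. Qed.

(** If Z is N(0, s^2) then c Z + m is N(m, (c s)^2), in terms of the density of
    the latter law. *)
Lemma ge0_integral_gaussian_affine (R : realType) (s m c : R) (f : R -> \bar R) :
  0 < s -> 0 < c -> measurable_fun setT f -> (forall x, 0 <= f x)%E ->
  (\int[normal_prob 0 s]_x f (c * x + m)%R =
   \int[@lebesgue_measure R]_z (f z * (normal_pdf m (c * s) z)%:E))%E.
Proof.
move=> s0 c0 mf f0.
have mcm : measurable_fun setT (fun x : R => c * x + m).
  by apply: measurable_funD => //; exact: measurable_funM.
have mpdf : measurable_fun setT (fun z : R => (normal_pdf m (c * s) z)%:E).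
  by apply/measurable_EFinP; exact: measurable_normal_pdf.
have fpdf0 z : (0 <= f z * (normal_pdf m (c * s) z)%:E)%E.
  by rewrite mule_ge0// lee_fin normal_pdf_ge0.
rewrite [LHS](ge0_integral_normal_prob 0 s (measurableT_comp mf mcm) (fun x => f0 _)).
rewrite -(ge0_integral_lebesgue_affine m c0 (emeasurable_funM mf mpdf))//.
rewrite -ge0_integralZl//; last 2 first.
- exact: (measurableT_comp (emeasurable_funM mf mpdf) mcm).
- by rewrite lee_fin ltW.
apply: eq_integral => x _; rewrite [RHS]muleCA -EFinM; congr (_ * _%:E)%E.
have s_neq0 : s != 0 by rewrite gt_eqF.
have c_neq0 : c != 0 by rewrite gt_eqF.
have cs_neq0 : c * s != 0 by rewrite mulf_neq0.
rewrite (normal_pdf_expE _ _ s_neq0) (normal_pdf_expE _ _ cs_neq0) mulrA.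
congr (_ * expR _); last by field; rewrite s_neq0.
rewrite /normal_peak.
have -> : (c * s) ^+ 2 * pi *+ 2 = c ^+ 2 * (s ^+ 2 * pi *+ 2) by ring.
by rewrite sqrtrM ?sqr_ge0// sqrtr_sqr gtr0_norm// invfM mulrA mulfV ?mul1r.
Qed.

(** The hypothesis [s != 0] is essential: for [s = 0] the density is by convention
    the indicator function of the unit interval, which is not even. *)
Lemma ge0_integral_gaussian_opp (R : realType) (s : R) (f : R -> \bar R) :
  s != 0 -> measurable_fun setT f -> (forall x, 0 <= f x)%E ->
  (\int[normal_prob 0 s]_x f (- x)%R = \int[normal_prob 0 s]_x f x)%E.
Proof.
move=> s0 mf f0.
have mN : measurable_fun setT (fun x : R => - x) by exact: measurable_funN.
have mpdf : measurable_fun setT (fun z : R => (normal_pdf 0 s z)%:E).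
  by apply/measurable_EFinP; exact: measurable_normal_pdf.
rewrite [LHS](ge0_integral_normal_prob 0 s (measurableT_comp mf mN) (fun x => f0 _)).
rewrite [RHS](ge0_integral_normal_prob 0 s mf f0).
rewrite -[RHS](ge0_integral_lebesgue_opp (emeasurable_funM mf mpdf)); last first.
  by move=> x; rewrite mule_ge0// lee_fin normal_pdf_ge0.
apply: eq_integral => x _; congr (_ * _%:E)%E.
by rewrite !normal_pdf_expE// !subr0 sqrrN.
Qed.

(** The joint density of (X, a X + b Y), for X and Y independent N(0, s^2), is
    factored as the density of Z = a X + b Y times the conditional density of
    X given Z. Completing the square in x in the exponent gives the conditional
    mean a z / c^2 and the conditional deviation b s / c. *)
Lemma normal_pdf_complete_square (R : realType) (s a b c x z : R) :
  0 < s -> 0 < b -> 0 < c -> c ^+ 2 = a ^+ 2 + b ^+ 2 ->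
  normal_pdf 0 s x * normal_pdf (a * x) (b * s) z =
  normal_pdf 0 (c * s) z * normal_pdf (a * z / c ^+ 2) (b * s / c) x.
Proof.
move=> s0 b0 c0 cE.
have s_neq0 : s != 0 by rewrite gt_eqF.
have b_neq0 : b != 0 by rewrite gt_eqF.
have c_neq0 : c != 0 by rewrite gt_eqF.
have ab_neq0 : a ^+ 2 + b ^+ 2 != 0 by rewrite -cE expf_neq0.
rewrite !normal_pdf_expE ?mulf_neq0 ?invr_neq0//.
rewrite mulrACA [RHS]mulrACA -!expRD; congr (_ * expR _).
  rewrite /normal_peak -!invfM -!sqrtrM ?mulrn_wge0 ?mulr_ge0 ?sqr_ge0 ?pi_ge0 ?ltW//.
  by congr (Num.sqrt _)^-1; field.
rewrite expr_div_n !exprMn cE; field.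
by rewrite s_neq0 b_neq0 ab_neq0.
Qed.

(** Stability of the normal law, for X and Y independent N(0, s^2). After the
    substitution z = a x + b y and an exchange of the integrals, the factor
    depending on x is a normal density by [normal_pdf_complete_square], so it
    integrates to 1. The image law is written as that of a multiple of one
    fixed normal variable, which remains meaningful when [a = b = 0]. *)
Lemma gaussian_convolution (R : realType) (s a b : R) (f : R -> \bar R) :
  0 < s -> measurable_fun setT f -> (forall x, 0 <= f x)%E ->
  (\int[normal_prob 0 s]_x \int[normal_prob 0 s]_y f (a * x + b * y)%R =
   \int[normal_prob 0 s]_z f (Num.sqrt (a ^+ 2 + b ^+ 2) * z)%R)%E.
Proof.
move=> s0; have sn0 : s != 0 by rewrite gt_eqF.
wlog b0 : b f / 0 <= b.
  move=> H mf f0; have [|b0] := leP 0 b; first by move=> /H; exact.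
  have -> : a ^+ 2 + b ^+ 2 = a ^+ 2 + (- b) ^+ 2 by rewrite sqrrN.
  transitivity (\int[normal_prob 0 s]_x \int[normal_prob 0 s]_y
    f (a * x + - b * y)%R)%E; last by apply: H; rewrite ?oppr_ge0// ltW.
  apply: eq_integral => x _.
  have mg : measurable_fun setT (fun y => f (a * x + b * y)%R).
    apply: measurableT_comp => //; exact: measurable_funD.
  rewrite -[LHS](ge0_integral_gaussian_opp sn0 mg (fun=> f0 _)).
  by apply: eq_integral => y _; rewrite mulrN mulNr.
move=> mf f0.
move: b0; rewrite le_eqVlt => /predU1P[<-|b0].
  rewrite expr0n addr0 sqrtr_sqr.
  under eq_integral do under eq_integral do rewrite mul0r addr0.
  under eq_integral do rewrite probability_integral_cst.
  have [a0|a0] := leP 0 a; first by rewrite ger0_norm.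
  rewrite ltr0_norm//.
  have mg : measurable_fun setT (fun x => f (a * x)%R).
    exact: measurableT_comp.
  rewrite -[LHS](ge0_integral_gaussian_opp sn0 mg (fun=> f0 _)).
  by apply: eq_integral => x _; rewrite mulrN mulNr.
pose c := Num.sqrt (a ^+ 2 + b ^+ 2).
have ab0 : 0 < a ^+ 2 + b ^+ 2 by rewrite ltr_wpDl ?sqr_ge0 ?exprn_gt0.
have c0 : 0 < c by rewrite sqrtr_gt0.
have cE : c ^+ 2 = a ^+ 2 + b ^+ 2 by rewrite sqr_sqrtr// ltW.
have bs0 : b * s != 0 by rewrite mulf_neq0 ?gt_eqF.
pose G (xz : R * R) := (f xz.2 *
  (normal_pdf 0 s xz.1 * normal_pdf (a * xz.1) (b * s) xz.2)%:E)%E.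
have G0 xz : (0 <= G xz)%E.
  by rewrite mule_ge0// lee_fin mulr_ge0// normal_pdf_ge0.
have mpdf2 : measurable_fun setT
    (fun xz : R * R => normal_pdf (a * xz.1) (b * s) xz.2).
  rewrite [X in measurable_fun _ X](_ : _ = fun xz : R * R => normal_peak (b * s) *
     expR (- (xz.2 - a * xz.1) ^+ 2 / ((b * s) ^+ 2 *+ 2))); last first.
    by apply/funext => xz; rewrite normal_pdf_expE.
  apply: measurable_funM => //; apply: measurableT_comp => //.
  apply: measurable_funM => //; apply: measurable_funN.
  apply: measurable_funX; apply: measurable_funB => //.
  by apply: measurable_funM.
have mG : measurable_fun setT G.
  apply: emeasurable_funM; first exact: measurableT_comp.
  apply/measurable_EFinP; apply: measurable_funM => //.
  by apply: measurableT_comp => //; exact: measurable_normal_pdf.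
transitivity (\int[@lebesgue_measure R]_x \int[@lebesgue_measure R]_z G (x, z))%E.
  rewrite [LHS](ge0_integral_normal_prob 0 s); last 2 first.
  - have mF : measurable_fun setT (fun xy : R * R => f (a * xy.1 + b * xy.2)).
      apply: measurableT_comp => //.
      by apply: measurable_funD; apply: measurable_funM.
    exact: (measurable_fun_fubini_tonelli_F (m2 := normal_prob 0 s) _ mF).
  - by move=> x; apply: integral_ge0.
  apply: eq_integral => x _.
  under eq_integral do rewrite addrC.
  rewrite (ge0_integral_gaussian_affine _ s0 b0 mf f0) muleC.
  rewrite -ge0_integralZl//; last 3 first.
  - apply: emeasurable_funM => //.
    by apply/measurable_EFinP; exact: measurable_normal_pdf.
  - by move=> z _; rewrite mule_ge0// lee_fin normal_pdf_ge0.
  - by rewrite lee_fin normal_pdf_ge0.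
  by apply: eq_integral => z _; rewrite /G/= muleCA EFinM.
(* Integrate first in x, for fixed z. *)
rewrite [LHS](fubini_tonelli (m1 := @lebesgue_measure R)
  (m2 := @lebesgue_measure R) G mG G0).
rewrite [RHS](_ : _ = \int[@lebesgue_measure R]_z
   (f z * (normal_pdf 0 (c * s) z)%:E))%E; last first.
  rewrite -(ge0_integral_gaussian_affine 0 s0 c0 mf f0).
  by apply: eq_integral => z _; rewrite addr0.
apply: eq_integral => z _.
rewrite /G/=.
under eq_integral do rewrite (normal_pdf_complete_square _ _ s0 b0 c0 cE).
under eq_integral do rewrite EFinM muleA.
rewrite ge0_integralZl//.
- by rewrite integral_normal_pdf mule1.
- by apply/measurable_EFinP; exact: measurable_normal_pdf.
- by move=> x _; rewrite lee_fin normal_pdf_ge0.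
- by rewrite mule_ge0// lee_fin normal_pdf_ge0.
Qed.

Lemma is_derive_normal_pdf (R : realType) (s x : R) : s != 0 ->
  is_derive x 1 (fun x => - s ^+ 2 * normal_pdf 0 s x) (x * normal_pdf 0 s x).
Proof.
move=> s_neq0.
have -> : (fun x => - s ^+ 2 * normal_pdf 0 s x) =
    (fun x : R => (- s ^+ 2 * normal_peak s) * expR (- (s ^+ 2 *+ 2)^-1 * x ^+ 2)).
  apply/funext => y; rewrite normal_pdf_expE// subr0 mulrA; congr (_ * expR _).
  by rewrite mulNr mulrC mulNr.
apply: is_derive_eq.
rewrite normal_pdf_expE// subr0 !scaler1 /GRing.scale/=.
rewrite (_ : - (s ^+ 2 *+ 2)^-1 * x ^+ 2 = - x ^+ 2 / (s ^+ 2 *+ 2)); last first.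
  by rewrite mulNr mulrC mulNr.
by field.
Qed.

(** By symmetry this is twice an integral over the half-line, where x times the
    density has the primitive - s^2 times the density. *)
Lemma gaussian_abs_moment (R : realType) (s : R) : 0 < s ->
  (\int[normal_prob 0 s]_x (`|x|)%:E = (2 * s / Num.sqrt (2 * pi))%:E)%E.
Proof.
move=> s0; have sn0 : s != 0 by rewrite gt_eqF.
rewrite [LHS](ge0_integral_normal_prob 0 s); last 2 first.
- by apply/measurable_EFinP; exact: normr_measurable.
- by move=> x; rewrite lee_fin.
under eq_integral do rewrite -EFinM.
have cpdf := @continuous_normal_pdf _ 0 s sn0.
rewrite ge0_symfun_integralT; last 3 first.
- by move=> x; rewrite mulr_ge0// normal_pdf_ge0.
- by move=> x; apply: cvgM; [exact: norm_continuous|exact: cpdf].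
- by move=> x/=; rewrite normrN !normal_pdf_expE// !subr0 sqrrN.
rewrite -set_itvcy.
transitivity (2%:E * \int[@lebesgue_measure R]_(x in `[0%R, +oo[)
    (x * normal_pdf 0 s x)%:E)%E.
  congr (_ * _)%E; apply: eq_integral => x.
  by rewrite inE/= in_itv/= andbT => x0; rewrite ger0_norm.
rewrite (@ge0_continuous_FTC2y _ _ (fun x => - s ^+ 2 * normal_pdf 0 s x) 0 0); first last.
- by move=> x _; rewrite derive1E; case: (is_derive_normal_pdf x sn0).
- apply: cvg_at_right_filter; apply: cvgM; first exact: cvg_cst.
  exact: cpdf.
- by move=> x _; case: (is_derive_normal_pdf x sn0).
- have pdf0 : normal_pdf 0 s x @[x --> +oo] --> 0.
    have -> : normal_pdf 0 s = fun x => normal_peak s * gauss_fun ((Num.sqrt 2 * s)^-1 * x).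
      apply/funext => x; rewrite normal_pdf_expE// subr0 /gauss_fun.
      by rewrite exprMn exprVn exprMn sqr_sqrtr//; congr (_ * expR _); field.
    rewrite -[X in _ --> X](mulr0 (normal_peak s)).
    apply: cvgM; first exact: cvg_cst.
    apply: (cvg_comp _ _ _ cvg_gauss_fun); apply: gt0_cvgMry; last exact: cvg_id.
    by rewrite invr_gt0 mulr_gt0// sqrtr_gt0.
  rewrite -[X in _ --> X](mulr0 (- s ^+ 2)).
  by apply: cvgM; [exact: cvg_cst|exact: pdf0].
- apply: continuous_subspaceT => x; apply: cvgM; [exact: cvg_id|exact: cpdf].
- by move=> x x0; rewrite mulr_ge0// normal_pdf_ge0.
rewrite -EFinB -EFinM normal_pdf_expE// subr0 expr0n oppr0 mul0r expR0 mulr1.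
rewrite sub0r mulNr opprK /normal_peak; congr EFin.
have -> : s ^+ 2 * pi *+ 2 = s ^+ 2 * (2 * pi) by ring.
rewrite sqrtrM ?sqr_ge0// sqrtr_sqr gtr0_norm//.
field.
by rewrite sn0 gt_eqF// sqrtr_gt0 mulr_gt0// pi_gt0.
Qed.

(** Only the upper bound is needed, and it follows from 1 + k x^2 <= exp (k x^2).
    Multiplying the density of deviation s by exp (k x^2) produces r times the
    density of deviation r s when k = (1 - r^-2) / (2 s^2), so that
    1 + k E X^2 <= r. Letting r decrease to 1 gives the bound. *)
Lemma gaussian_second_moment_le (R : realType) (s : R) : 0 < s ->
  (\int[normal_prob 0 s]_x (x ^+ 2)%:E <= (s ^+ 2)%:E)%E.
Proof.
move=> s0; have sn0 : s != 0 by rewrite gt_eqF.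
have mX2 : measurable_fun setT (fun x : R => (x ^+ 2)%:E).
  by apply/measurable_EFinP; exact: exprn_measurable.
apply/lee_addgt0Pr => e e0.
(* [h] is chosen so that the final bound is at most [s ^+ 2 + e]. *)
pose h := e / (2 * s ^+ 2).
have h0 : 0 < h by rewrite divr_gt0// mulr_gt0// exprn_gt0.
pose r := 1 + h.
have r1 : 1 < r by rewrite ltrDl.
have r0 : 0 < r by exact: lt_trans r1.
pose k := (1 - (r ^+ 2)^-1) / (2 * s ^+ 2).
have k0 : 0 < k.
  by rewrite divr_gt0 ?mulr_gt0 ?exprn_gt0// subr_gt0 invf_lt1 ?exprn_gt0// exprn_egt1.
have bound x : normal_pdf 0 s x + k * x ^+ 2 * normal_pdf 0 s x <=
    r * normal_pdf 0 (r * s) x.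
  have rs0 : r * s != 0 by rewrite mulf_neq0 ?gt_eqF.
  apply: (@le_trans _ _ (expR (k * x ^+ 2) * normal_pdf 0 s x)).
    rewrite -{1}[normal_pdf 0 s x]mul1r -mulrDl ler_wpM2r ?normal_pdf_ge0//.
    exact: expR_ge1Dx.
  rewrite !normal_pdf_expE// mulrCA -expRD [leRHS]mulrA.
  rewrite le_eqVlt; apply/orP; left; apply/eqP; congr (_ * expR _).
    rewrite /normal_peak.
    have -> : (r * s) ^+ 2 * pi *+ 2 = r ^+ 2 * (s ^+ 2 * pi *+ 2) by ring.
    by rewrite sqrtrM ?sqr_ge0// sqrtr_sqr gtr0_norm// invfM mulrA mulfV ?mul1r// gt_eqF.
  by rewrite /k; field; rewrite sn0 gt_eqF.
have mpdf t : measurable_fun setT (fun x : R => (normal_pdf 0 t x)%:E).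
  by apply/measurable_EFinP; exact: measurable_normal_pdf.
have mX2pdf : measurable_fun setT (fun x : R => (x ^+ 2)%:E * (normal_pdf 0 s x)%:E)%E.
  exact: emeasurable_funM.
have X2pdf0 x : (0 <= (x ^+ 2)%:E * (normal_pdf 0 s x)%:E)%E.
  by rewrite mule_ge0// lee_fin ?sqr_ge0// normal_pdf_ge0.
set I := (\int[normal_prob 0 s]_x _)%E.
have IE : (I = \int[@lebesgue_measure R]_x ((x ^+ 2)%:E * (normal_pdf 0 s x)%:E))%E.
  apply: (ge0_integral_normal_prob 0 s mX2).
  by move=> x; rewrite lee_fin sqr_ge0.
have H : (1 + k%:E * I <= r%:E)%E.
  rewrite IE -(integral_normal_pdf 0 s) -ge0_integralZl//; last by rewrite lee_fin ltW.
  rewrite -ge0_integralD//; last 4 first.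
  - by move=> x _; rewrite lee_fin normal_pdf_ge0.
  - exact: mpdf.
  - by move=> x _; rewrite mule_ge0// lee_fin ltW.
  - exact: measurable_funeM.
  rewrite -[leRHS]mule1 -(integral_normal_pdf 0 (r * s)) -ge0_integralZl//; last 3 first.
  - exact: mpdf.
  - by move=> x _; rewrite lee_fin normal_pdf_ge0.
  - by rewrite lee_fin ltW.
  apply: ge0_le_integral => //.
  - move=> x _; rewrite adde_ge0//; first by rewrite lee_fin normal_pdf_ge0.
    by rewrite mule_ge0// lee_fin ltW.
  - apply: emeasurable_funD; first exact: mpdf.
    exact: measurable_funeM.
  - apply: measurable_funeM; exact: mpdf.
  - by move=> x _; rewrite -!EFinM -EFinD lee_fin mulrA.
have I0 : (0 <= I)%E by apply: integral_ge0 => x _; rewrite lee_fin sqr_ge0.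
have : (I <= ((r - 1) / k)%:E)%E.
  rewrite EFinM lee_pdivlMr// muleC EFinB leeBrDl//; exact: H.
move=> /le_trans; apply; rewrite -EFinD lee_fin.
rewrite ler_pdivrMr// /k.
have -> : r - 1 = h by rewrite /r addrAC subrr add0r.
have -> : e = h * (2 * s ^+ 2) by rewrite divfK// mulf_neq0// expf_neq0.
rewrite -subr_ge0.
have -> : (s ^+ 2 + h * (2 * s ^+ 2)) * ((1 - (r ^+ 2)^-1) / (2 * s ^+ 2)) - h =
    h ^+ 2 / (2 * r ^+ 2).
  rewrite /r; field.
  by rewrite sn0 gt_eqF.
by rewrite divr_ge0 ?sqr_ge0// mulr_ge0 ?sqr_ge0.
Qed.

(** * Borel sets of R^p *)

(** Row vectors as a measurable space; its measurable sets are, by definition,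
    those of [borel]. *)
Definition rV_borel (R : realType) (p : nat) :=
  g_sigma_algebraType [set A : set 'rV[R]_p | open A].

Lemma continuous_measurable_rV (R : realType) (p : nat) (f : 'rV[R]_p -> R) :
  continuous f -> measurable_fun setT (f : rV_borel R p -> R).
Proof.
move=> /continuousP cf; apply: (measurability _ (RGenOpens.measurableE R)).
move=> _ [_ [a [b ->] <-]]; rewrite setTI; apply: sub_sigma_algebra.
exact/cf/interval_open.
Qed.

(** Second countability of R^p, with the balls of rational centre and radius 1/(n+1)
    in the sup norm. These balls are boxes, which is what reduces Borel
    measurability to coordinates. *)
Lemma open_bigcup_rat_ball (R : realType) (p : nat) (A : set 'rV[R]_p) : open A ->
  A = \bigcup_(k : 'rV[rat]_p * nat)
    if `[< ball (map_mx ratr k.1 : 'rV[R]_p) (k.2.+1%:R^-1 : R) `<=` A >]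
    then ball (map_mx ratr k.1 : 'rV[R]_p) (k.2.+1%:R^-1 : R) else set0.
Proof.
move=> oA; apply/seteqP; split => [x Ax|x [k _]]; last by case: asboolP => // kA /kA.
have /nbhs_ballP[e /= e0 xeA] : nbhs x A by exact: open_nbhs_nbhs.
have [n ne] : exists n, n.+1%:R^-1 < e / 2.
  have /ltr_add_invr[n] : 0 < e / 2 by rewrite divr_gt0.
  by rewrite add0r; exists n.
have n0 : (0 : R) < n.+1%:R^-1 by rewrite invr_gt0.
have q_ex i : exists q : rat, `|x ord0 i - (ratr q : R)| < n.+1%:R^-1.
  have /rat_in_itvoo[q] : x ord0 i < x ord0 i + n.+1%:R^-1 by rewrite ltrDl.
  rewrite in_itv/= => /andP[xq qx]; exists q.
  by rewrite distrC gtr0_norm ?subr_gt0// ltrBlDl.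
have [q qx] := choice q_ex.
exists (\row_i q i, n) => //=.
have qxn : ball (map_mx ratr (\row_i q i) : 'rV[R]_p) n.+1%:R^-1 x.
  split => // i j; rewrite ord1 !mxE /ball/= distrC; exact: qx.
case: asboolP => // -[] y qy; apply: xeA.
(* [x] lies within 1/(n+1) of the centre, so the ball has points at distance up
   to 2/(n+1) from [x]. *)
apply: (@le_ball _ _ _ (n.+1%:R^-1 + n.+1%:R^-1)).
  by rewrite ltW// [ltRHS]splitr ltrD.
exact: ball_triangle (ball_sym qxn) qy.
Qed.

Lemma measurable_fun_rV (R : realType) (p : nat) d (T : measurableType d)
    (f : T -> 'rV[R]_p) :
  (forall i, measurable_fun setT (fun w => f w ord0 i)) ->
  measurable_fun setT (f : T -> rV_borel R p).
Proof.
move=> mf; apply: (@measurability _ _ T (rV_borel R p) setT f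
  [set A : set 'rV[R]_p | open A]) => //.
move=> _ [A oA <-]; rewrite setTI (open_bigcup_rat_ball oA) preimage_bigcup.
apply: countable_bigcupT_measurable => // -[q n]/=.
case: asboolP => _; last by rewrite preimage_set0.
rewrite (_ : _ @^-1` _ = \bigcap_(i in [set: 'I_p])
   (fun w => f w ord0 i) @^-1` ball (ratr (q ord0 i) : R) n.+1%:R^-1); last first.
  apply/seteqP; split => [w [_ H] i _|w H].
    by have := H ord0 i; rewrite mxE.
  by split; [rewrite invr_gt0|move=> i j; rewrite ord1 mxE; exact: H].
apply: fin_bigcap_measurable => // i _.
by rewrite -[X in measurable X]setTI; apply: mf => //; exact: measurable_ball.
Qed.

Lemma measurable_coord (R : realType) (p : nat) (i : 'I_p) :
  measurable_fun setT (fun x : rV_borel R p => (x : 'rV[R]_p) ord0 i).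
Proof. by apply: continuous_measurable_rV; exact: coord_continuous. Qed.

Lemma measurable_rV_addZ (R : realType) (p : nat) d (T : measurableType d)
    (a : R) (U V : T -> 'rV[R]_p) :
  measurable_fun setT (U : T -> rV_borel R p) ->
  measurable_fun setT (V : T -> rV_borel R p) ->
  measurable_fun setT ((fun w => U w + a *: V w) : T -> rV_borel R p).
Proof.
move=> mU mV; apply: measurable_fun_rV => i.
rewrite (_ : (fun w => _) = (fun w => U w ord0 i + a * V w ord0 i)); last first.
  by apply/funext => w; rewrite !mxE.
apply: measurable_funD; first exact: (measurableT_comp (measurable_coord i) mU).
by apply: measurable_funM => //; exact: (measurableT_comp (measurable_coord i) mV).
Qed.

Lemma measurable_rV_opp (R : realType) (p : nat) d (T : measurableType d)
    (V : T -> 'rV[R]_p) :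
  measurable_fun setT (V : T -> rV_borel R p) ->
  measurable_fun setT ((fun w => - V w) : T -> rV_borel R p).
Proof.
move=> mV; apply: measurable_fun_rV => i.
rewrite (_ : (fun w => _) = (fun w => - V w ord0 i)); last first.
  by apply/funext => w; rewrite mxE.
by apply: measurable_funN; exact: (measurableT_comp (measurable_coord i) mV).
Qed.

(** * Gaussian vectors *)

(** A combination of independent N(0, s^2) variables is distributed as the
    Euclidean norm of its coefficients times one such variable. The induction
    adds one variable at a time by [gaussian_convolution], which requires the
    independence of the partial sum and the next variable. It is obtained by
    applying the induction hypothesis to the measure restricted to an event
    about that variable. Restriction does not preserve total mass 1, whence
    the arbitrary measure [m] and the factor [q]. *)
Lemma gaussian_combination_law d (Omega : measurableType d) (R : realType)
    (s : R) (X : nat -> Omega -> R) (g : nat -> R) :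
  0 < s -> (forall i, measurable_fun setT (X i)) ->
  forall n (m : {measure set Omega -> \bar R}) (q : {nonneg R}),
  (forall A : nat -> set R, (forall i, measurable (A i)) ->
    m [set w | forall i, (i < n)%N -> A i (X i w)] =
    (q%:num%:E * \prod_(i < n) normal_prob 0 s (A i))%E) ->
  forall A, measurable A ->
  m ((fun w => \sum_(i < n) g i * X i w) @^-1` A) =
  (q%:num%:E * normal_prob 0 s
     ((fun z => Num.sqrt (\sum_(i < n) g i ^+ 2) * z)%R @^-1` A))%E.
Proof.
move=> s0 mX; elim=> [m q mE A mA|n IH m q mE A mA].
  have mT : m setT = q%:num%:E.
    have := mE (fun=> setT) (fun=> measurableT); rewrite big_ord0 mule1 => <-.
    by congr (m _); apply/seteqP; split.
  have -> : (fun w => \sum_(i < 0) g i * X i w) = cst 0.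
    by apply/funext => w; rewrite big_ord0.
  have -> : (fun z => Num.sqrt (\sum_(i < 0) g i ^+ 2) * z) = cst 0.
    by apply/funext => z; rewrite big_ord0 sqrtr0 mul0r.
  rewrite !preimage_cst; case: ifPn => _; last by rewrite !measure0 mule0.
  rewrite mT [X in (_ * X)%E](_ : _ = 1%E) ?mule1//.
  exact: probability_setT.
pose S w := \sum_(i < n) g i * X i w.
have mS : measurable_fun setT S.
  by apply: measurable_sum => i; exact: measurable_funM.
pose c : R := Num.sqrt (\sum_(i < n) g i ^+ 2).
have mc : measurable_fun setT (fun z : measurableTypeR R => c * z : measurableTypeR R).
  exact: measurable_funM.
pose cM : {mfun measurableTypeR R >-> measurableTypeR R} := HB.pack (fun z : R => c * z)
  (isMeasurableFun.Build _ _ _ _ _ mc).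
pose m1 := mscale q (distribution (normal_prob 0 s) cM).
have mSX : measurable_fun setT
    (fun w => (S w, X n w) : measurableTypeR R * measurableTypeR R).
  by apply: measurable_fun_pair; [exact: mS|exact: mX].
pose m' := image_measure m mSX.
have m'E : forall B, measurable B -> (m1 \x normal_prob 0 s)%E B = m' B.
  apply: product_measure_unique => B C mB mC.
  have mXC : measurable (X n @^-1` C) by rewrite -[X in measurable X]setTI; exact: mX.
  have qC0 : 0 <= q%:num * fine (normal_prob 0 s C).
    by rewrite mulr_ge0// fine_ge0.
  have finC : normal_prob 0 s C \is a fin_num by exact: fin_num_measure.
  have := IH (mrestr m mXC) (NngNum qC0) _ B mB.
  rewrite /mrestr /= => H; rewrite /m1 /mscale/= /distribution/pushforward.
  rewrite [LHS]H; last first.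
    move=> D mD.
    (* The event about the last variable is a box with side [C] in direction n. *)
    pose D' i := if (i < n)%N then D i else C.
    have D'n : D' n = C by rewrite /D' ltnn.
    have := mE D' _; rewrite big_ord_recr/= D'n => H'.
    rewrite [LHS](_ : _ = m [set w | forall i, (i < n.+1)%N -> D' i (X i w)]).
      rewrite H'; last by move=> i; rewrite /D'; case: ifP.
      rewrite (eq_bigr (fun i : 'I_n => normal_prob 0 s (D i))).
        rewrite EFinM fineK// -muleA; congr (_ * _)%E; rewrite muleC //.
      by move=> i _; rewrite /D' ltn_ord.
    congr (m _); apply/seteqP; split => [w [H1 H2] i|w H1].
      rewrite ltnS leq_eqVlt => /predU1P[->|il]; rewrite /D' ?ltnn ?il//.
      exact: H1.
    split => [i il|]; last by have := H1 n (ltnSn n); rewrite /D' ltnn.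
    by have := H1 i (ltnW il); rewrite /D' il.
  by rewrite EFinM fineK// muleAC.
pose phi (xy : measurableTypeR R * measurableTypeR R) : measurableTypeR R :=
  xy.1 + g n * xy.2.
have mphi : measurable_fun setT phi.
  by apply: measurable_funD => //; exact: measurable_funM.
have mphiA : measurable (phi @^-1` A).
  by rewrite -[X in measurable X]setTI; exact: mphi.
transitivity ((m1 \x normal_prob 0 s)%E (phi @^-1` A)).
  rewrite m'E//; congr (m _); apply/funext => w.
  by rewrite /preimage/= big_ord_recr.
pose f (z : measurableTypeR R) : \bar R := (\1_A z)%:E.
have mf : measurable_fun setT f by apply/measurable_EFinP; exact: measurable_indic.
have f0 z : (0 <= f z)%E by rewrite lee_fin.
have mfphi : measurable_fun setT (f \o phi) by exact: measurableT_comp.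
transitivity (\int[m1 \x normal_prob 0 s]_xy (f \o phi) xy)%E.
  transitivity (\int[m1 \x normal_prob 0 s]_xy (\1_(phi @^-1` A) xy)%:E)%E.
    by rewrite [RHS](@integral_indic _ _ _ (m1 \x normal_prob 0 s)%E setT
      measurableT _ mphiA) setIT.
  by apply: eq_integral => xy _.
rewrite (fubini_tonelli1 _ mfphi (fun=> f0 _)).
have mF : measurable_fun setT (fubini_F (normal_prob 0 s) (f \o phi)).
  exact: (measurable_fun_fubini_tonelli_F (m2 := normal_prob 0 s) _ mfphi (fun=> f0 _)).
have F0 x : (0 <= fubini_F (normal_prob 0 s) (f \o phi) x)%E.
  by apply: integral_ge0 => y _; exact: f0.
rewrite (ge0_integral_mscale _ measurableT _ mF) //; congr (_ * _)%E.
rewrite (ge0_integral_pushforward mc _ measurableT mF) //.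
rewrite preimage_setT.
transitivity (\int[normal_prob 0 s]_x \int[normal_prob 0 s]_y f (c * x + g n * y)%R)%E.
  by [].
rewrite (gaussian_convolution _ _ s0 mf f0).
rewrite big_ord_recr/= sqr_sqrtr; last by apply: sumr_ge0 => i _; exact: sqr_ge0.
set c' := Num.sqrt _.
have mc'f : measurable_fun setT (fun z : measurableTypeR R => c' * z : measurableTypeR R).
  exact: measurable_funM.
have mc' : measurable ((fun z : measurableTypeR R => c' * z : measurableTypeR R) @^-1` A).
  by rewrite -[X in measurable X]setTI; exact: mc'f.
transitivity (\int[normal_prob 0 s]_z
    (\1_((fun z : measurableTypeR R => c' * z) @^-1` A) z)%:E)%E.
  by apply: eq_integral => z _.
by rewrite [LHS](@integral_indic _ _ _ (normal_prob 0 s) setT measurableT _ mc') setIT.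
Qed.

Lemma isotropic_gaussian_measurable d (Omega : measurableType d) (R : realType)
    (P : probability Omega R) (p : nat) (s : R) (V : Omega -> 'rV[R]_p) :
  isotropic_gaussian P s V -> measurable_fun setT (V : Omega -> rV_borel R p).
Proof. by move=> [mV _] _ A mA; rewrite setTI; exact: mV. Qed.

Lemma ge0_expectation_inner_gaussian d (Omega : measurableType d) (R : realType)
    (P : probability Omega R) (p : nat) (s : R) (V : Omega -> 'rV[R]_p)
    (g : 'rV[R]_p) (f : R -> \bar R) :
  0 < s -> isotropic_gaussian P s V ->
  measurable_fun setT f -> (forall x, 0 <= f x)%E ->
  (\int[P]_w f (\sum_(i < p) g ord0 i * V w ord0 i)%R =
   \int[normal_prob 0 s]_z f (enorm g * z)%R)%E.
Proof.
move=> s0 gV mf f0; have mV := isotropic_gaussian_measurable gV.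
have [_ boxV] := gV.
(* Coordinates are indexed by all natural numbers, with value 0 from p on. *)
pose coord (x : 'rV[R]_p) (i : nat) : R := oapp (x ord0) 0 (insub i).
have coordE x (i : 'I_p) : coord x i = x ord0 i by rewrite /coord valK.
have mX i : measurable_fun setT (fun w => coord (V w) i).
  rewrite /coord; case: insub => [j|]; last exact: measurable_cst.
  exact: (measurableT_comp (measurable_coord j) mV).
pose S w := \sum_(i < p) coord g i * coord (V w) i.
have mS : measurable_fun setT S.
  by apply: measurable_sum => i; exact: measurable_funM.
have SE w : \sum_(i < p) g ord0 i * V w ord0 i = S w.
  by apply: eq_bigr => i _; rewrite !coordE.
have mc : measurable_fun setT
    (fun z : measurableTypeR R => enorm g * z : measurableTypeR R).
  exact: measurable_funM.
have law A : measurable A -> P (S @^-1` A) =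
    normal_prob 0 s ((fun z : measurableTypeR R => enorm g * z) @^-1` A).
  have PX (B : nat -> set R) : (forall i, measurable (B i)) ->
      P [set w | forall i, (i < p)%N -> B i (coord (V w) i)] =
      ((1 : R)%:E * \prod_(i < p) normal_prob 0 s (B i))%E.
    move=> mB; rewrite mul1e -(boxV (fun i => B i))//.
    congr (P _); apply/seteqP; split => w H i.
      by rewrite -coordE; exact: (H i (ltn_ord i)).
    by move=> ip; have := H (Ordinal ip); rewrite -(coordE _ (Ordinal ip)).
  move=> mA.
  have := gaussian_combination_law (coord g) s0 mX (n := p) (m := P) (q := 1%:nng) PX mA.
  move=> E; rewrite [LHS]E mul1e.
  suff -> : \sum_(i < p) coord g i ^+ 2 = \sum_(i < p) g ord0 i ^+ 2 by [].
  by apply: eq_bigr => i _; rewrite coordE.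
under eq_integral do rewrite SE.
rewrite -[LHS](ge0_integral_pushforward (phi := S : Omega -> measurableTypeR R)
  mS _ measurableT mf); last by move=> *; exact: f0.
rewrite -[RHS](ge0_integral_pushforward mc _ measurableT mf); last by move=> *; exact: f0.
by apply: eq_measure_integral => A mA _; exact: law.
Qed.

Lemma normal_prob_opp (R : realType) (s : R) (A : set R) : s != 0 -> measurable A ->
  normal_prob 0 s (-%R @^-1` A) = normal_prob 0 s A.
Proof.
move=> s0 mA.
have mNA : measurable (-%R @^-1` A : set R).
  by rewrite -[X in measurable X]setTI; exact: (@oppr_measurable R setT).
have mf : measurable_fun setT (fun z : R => (\1_A z : R)%:E).
  by apply/measurable_EFinP; exact: measurable_indic.
transitivity (\int[normal_prob 0 s]_z (\1_(-%R @^-1` A : set R) z)%:E)%E.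
  by rewrite [RHS](@integral_indic _ _ _ (normal_prob 0 s) setT measurableT _ mNA) setIT.
transitivity (\int[normal_prob 0 s]_z (\1_A z)%:E)%E; last first.
  by rewrite [LHS](@integral_indic _ _ _ (normal_prob 0 s) setT measurableT _ mA) setIT.
have f0 z : (0 <= (\1_A z : R)%:E)%E by rewrite lee_fin.
rewrite -[RHS](ge0_integral_gaussian_opp s0 mf f0).
by apply: eq_integral => z _.
Qed.

Definition boxes (R : realType) (p : nat) : set_system 'rV[R]_p :=
  [set B | exists2 A : 'I_p -> set R, (forall i, measurable (A i)) &
     B = [set x : 'rV[R]_p | forall i, A i (x ord0 i)]].

(** Boxes are the sets on which the law of a gaussian vector is prescribed, so this
    makes that law unique on all Borel sets. *)
Lemma rV_borel_boxes (R : realType) (p : nat) :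
  @measurable _ (rV_borel R p) = <<s @boxes R p >>.
Proof.
apply/seteqP; split.
  apply: smallest_sub; first exact: smallest_sigma_algebra.
  move=> A oA.
  have mid : measurable_fun setT
      (fun x : g_sigma_algebraType (@boxes R p) => (x : rV_borel R p)).
    apply: measurable_fun_rV => i _ B mB; rewrite setTI; apply: sub_sigma_algebra.
    exists (fun j => if j == i then B else setT).
      by move=> j; case: ifP.
    apply/seteqP; split => [x Bx j|x /(_ i)]; last by rewrite eqxx.
    by case: eqP => // ->.
  rewrite -[A]setTI; apply: mid => //; exact: sub_sigma_algebra.
apply: smallest_sub; first exact: sigma_algebra_measurable.
move=> _ [A mA ->].
rewrite (_ : mkset _ = \bigcap_(i in [set: 'I_p])
   (fun x : rV_borel R p => (x : 'rV[R]_p) ord0 i) @^-1` A i); last first.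
  by apply/seteqP; split => x H i; [move=> _|]; exact: H.
apply: fin_bigcap_measurable => // i _.
by rewrite -[X in measurable X]setTI; apply: measurable_coord.
Qed.

(** V and -V give the same mass to every box, by symmetry of each factor; boxes are
    stable under intersection and generate the Borel sets. *)
Lemma ge0_expectation_gaussian_opp d (Omega : measurableType d) (R : realType)
    (P : probability Omega R) (p : nat) (s : R) (V : Omega -> 'rV[R]_p)
    (h : 'rV[R]_p -> \bar R) :
  s != 0 -> isotropic_gaussian P s V ->
  measurable_fun setT (h : rV_borel R p -> \bar R) -> (forall x, 0 <= h x)%E ->
  (\int[P]_w h (- V w)%R = \int[P]_w h (V w))%E.
Proof.
move=> s0 gV mh h0; have mV := isotropic_gaussian_measurable gV.
have [_ boxV] := gV.
have mNV := measurable_rV_opp mV.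
rewrite -[LHS](ge0_integral_pushforward mNV _ measurableT mh); last by move=> *; exact: h0.
rewrite -[RHS](ge0_integral_pushforward mV _ measurableT mh); last by move=> *; exact: h0.
apply: eq_measure_integral => A mA _.
apply: (@measure_unique _ R (rV_borel R p) (@boxes R p) (fun=> setT)) => //.
- exact: rV_borel_boxes.
- move=> _ _ [A1 mA1 ->] [A2 mA2 ->]; exists (fun i => A1 i `&` A2 i).
    by move=> i; exact: measurableI.
  apply/seteqP; split => [x [H1 H2] i|x H]; first by split; [exact: H1|exact: H2].
  by split => i; case: (H i).
- by move=> _; exists (fun=> setT) => //; apply/seteqP; split.
- by apply/seteqP; split => // x _; exists 0%N.
- move=> _ [B mB ->].
  rewrite /= /pushforward.
  transitivity (\prod_(i < p) normal_prob 0 s (B i))%E; last first.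
    by rewrite -boxV.
  transitivity (\prod_(i < p) normal_prob 0 s (-%R @^-1` B i))%E; last first.
    by apply: eq_bigr => i _; exact: normal_prob_opp.
  rewrite -boxV; last first.
    move=> i; rewrite -[X in measurable X]setTI.
    exact: (@oppr_measurable R setT).
  congr (P _); apply/seteqP; split => w H i; have := H i; rewrite /= ?mxE//.
- move=> _; rewrite /= /pushforward preimage_setT.
  by rewrite probability_setT ltry.
Qed.

(** * Independence of the iterates and the draws *)

(** Independence identifies the joint law with the product of the two laws; Tonelli
    then allows X to be frozen while Y is averaged. *)
Lemma ge0_expectation_indep d d1 d2 (Omega : measurableType d)
    (T1 : measurableType d1) (T2 : measurableType d2) (R : realType)
    (P : probability Omega R) (X : Omega -> T1) (Y : Omega -> T2)
    (F : T1 * T2 -> \bar R) :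
  measurable_fun setT X -> measurable_fun setT Y ->
  (forall A B, measurable A -> measurable B ->
    P (X @^-1` A `&` Y @^-1` B) = P (X @^-1` A) * P (Y @^-1` B))%E ->
  measurable_fun setT F -> (forall xy, 0 <= F xy)%E ->
  (\int[P]_w F (X w, Y w) = \int[P]_w \int[P]_w' F (X w, Y w'))%E.
Proof.
move=> mX mY indep mF F0.
pose lawX := distribution P
  (HB.pack X (isMeasurableFun.Build _ _ _ _ _ mX) : {mfun Omega >-> T1}).
pose lawY := distribution P
  (HB.pack Y (isMeasurableFun.Build _ _ _ _ _ mY) : {mfun Omega >-> T2}).
have mXY : measurable_fun setT (fun w => (X w, Y w)) by exact: measurable_fun_pair.
rewrite -[LHS](ge0_integral_pushforward mXY _ measurableT mF); last by move=> *; exact: F0.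
transitivity (\int[lawX \x lawY]_xy F xy)%E.
  apply: eq_measure_integral => A mA _; apply/esym.
  by apply: product_measure_unique.
rewrite (fubini_tonelli1 _ mF F0).
have mFF : measurable_fun setT (fubini_F lawY F).
  exact: (measurable_fun_fubini_tonelli_F (m2 := lawY) _ mF F0).
rewrite [LHS](ge0_integral_pushforward mX _ measurableT mFF); last first.
  by move=> *; apply: integral_ge0.
apply: eq_integral => w _; rewrite /= /fubini_F.
rewrite [LHS](ge0_integral_pushforward mY _ measurableT) //.
exact: measurableT_comp.
Qed.

Lemma measurable_search_step d (T : measurableType d) (R : realType) (p : nat)
    (o o' : 'rV[R]_p -> R) (a : R) (U V : T -> 'rV[R]_p) :
  continuous o -> continuous o' ->
  measurable_fun setT (U : T -> rV_borel R p) ->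
  measurable_fun setT (V : T -> rV_borel R p) ->
  measurable_fun setT ((fun w =>
    if o' (U w + a *: V w) <= o (U w) then U w + a *: V w else U w)
    : T -> rV_borel R p).
Proof.
move=> co co' mU mV.
have mUV := measurable_rV_addZ a mU mV.
apply: measurable_fun_ifT => //; apply: measurable_fun_ler.
- exact: (measurableT_comp (continuous_measurable_rV co') mUV).
- exact: (measurableT_comp (continuous_measurable_rV co) mU).
Qed.

Definition past_draws_gen (Omega : Type) (R : realType) (p : nat)
    (v : nat -> Omega -> 'rV[R]_p) (t : nat) : set_system Omega :=
  [set B | exists s A, [/\ (s < t)%N, ~~ odd s, borel A & B = v s @^-1` A]].

(** Each selection is a measurable function of the current iterate and the new
    draw. This is the only use of the continuity of the oracle, and it is what
    makes [u t] independent of [v t]. *)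
Lemma search_iterate_past d (Omega : measurableType d) (R : realType) (p : nat)
    (oracle : nat -> 'rV[R]_p -> R) (u0 : 'rV[R]_p) (delta : nat -> R)
    (v u : nat -> Omega -> 'rV[R]_p) :
  (forall t, continuous (oracle t)) ->
  two_point_direct_search oracle u0 delta v u ->
  forall t, ~~ odd t -> forall A, borel A -> past_draws v t (u t @^-1` A).
Proof.
move=> co su t t_even; rewrite -(even_halfK t_even).
elim: t./2 => [|k IH] A bA.
  have -> : u (0.*2)%N = cst u0 by apply/funext => w; exact: (search_init su).
  rewrite preimage_cst; case: ifPn => _; last exact: sigma_algebra0.
  exact: (@measurableT _ (g_sigma_algebraType (past_draws_gen v 0))).
have ek : ~~ odd k.*2 by rewrite odd_double.
have mU : measurable_fun setT
    (u k.*2 : g_sigma_algebraType (past_draws_gen v k.*2.+2) -> rV_borel R p).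
  move=> _ B mB; rewrite setTI.
  apply: sub_sigma_algebra2 (IH B mB) => C [s [D [sk es bD ->]]].
  by exists s, D; split => //; exact: (leq_trans sk (leqW (leqnSn _))).
have mV : measurable_fun setT
    (v k.*2 : g_sigma_algebraType (past_draws_gen v k.*2.+2) -> rV_borel R p).
  move=> _ B mB; rewrite setTI; apply: sub_sigma_algebra.
  by exists k.*2, B; split.
have mstep := measurable_search_step (delta k.*2) (co k.*2) (co k.*2.+1) mU mV.
rewrite doubleS /past_draws -/(past_draws_gen v k.*2.+2).
rewrite [X in X @^-1` A](_ : u k.*2.+2 = (fun w =>
    if oracle k.*2.+1 (u k.*2 w + delta k.*2 *: v k.*2 w) <= oracle k.*2 (u k.*2 w)
    then u k.*2 w + delta k.*2 *: v k.*2 w else u k.*2 w)).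
  by rewrite -[X in <<s _ >> X]setTI; exact: mstep.
by apply/funext => w; rewrite (search_select su)// (search_probe su).
Qed.

(** * Functions with Lipschitz gradient *)

Lemma enorm_ge0 (R : realType) (p : nat) (x : 'rV[R]_p) : 0 <= enorm x.
Proof. exact: sqrtr_ge0. Qed.

Lemma enorm_sqr (R : realType) (p : nat) (x : 'rV[R]_p) :
  enorm x ^+ 2 = \sum_(i < p) x ord0 i ^+ 2.
Proof. by rewrite sqr_sqrtr// sumr_ge0// => i _; exact: sqr_ge0. Qed.

Lemma enormZ (R : realType) (p : nat) (a : R) (x : 'rV[R]_p) :
  enorm (a *: x) = `|a| * enorm x.
Proof.
rewrite /enorm -sqrtr_sqr -sqrtrM ?sqr_ge0// mulr_sumr; congr Num.sqrt.
by apply: eq_bigr => i _; rewrite mxE exprMn.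
Qed.

Lemma enorm_eq0 (R : realType) (p : nat) (x : 'rV[R]_p) : enorm x = 0 ->
  forall i, x ord0 i = 0.
Proof.
move=> x0 i; have := enorm_sqr x; rewrite x0 expr0n/= => /esym/eqP.
rewrite psumr_eq0; last by move=> j _; exact: sqr_ge0.
by move=> /allP/(_ i); rewrite mem_index_enum sqrf_eq0 => /(_ isT)/eqP.
Qed.

(** Cauchy-Schwarz, from the nonnegativity of the sum of the squares of
    x_i |y| - y_i |x|. *)
Lemma inner_le_enorm (R : realType) (p : nat) (x y : 'rV[R]_p) :
  \sum_(i < p) x ord0 i * y ord0 i <= enorm x * enorm y.
Proof.
have [x0|xn0] := eqVneq (enorm x) 0.
  by rewrite x0 mul0r big1// => i _; rewrite enorm_eq0// mul0r.
have [y0|yn0] := eqVneq (enorm y) 0.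
  by rewrite y0 mulr0 big1// => i _; rewrite (enorm_eq0 y0) mulr0.
have xy0 : 0 < 2 * (enorm x * enorm y).
  by rewrite !mulr_gt0// lt_def ?xn0 ?yn0 enorm_ge0.
rewrite -(ler_pM2l xy0).
have : 0 <= \sum_(i < p) (x ord0 i * enorm y - y ord0 i * enorm x) ^+ 2.
  by apply: sumr_ge0 => i _; exact: sqr_ge0.
rewrite (eq_bigr (fun i => x ord0 i ^+ 2 * enorm y ^+ 2 + y ord0 i ^+ 2 * enorm x ^+ 2
   - (x ord0 i * y ord0 i) * (2 * (enorm x * enorm y)))); last first.
  by move=> i _; ring.
rewrite sumrB big_split/= -!mulr_suml -!enorm_sqr subr_ge0 mulrC => /le_trans; apply.
rewrite le_eqVlt; apply/orP; left; apply/eqP; ring.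
Qed.

Lemma derive_gradient (R : realType) (p : nat) (f : 'rV[R]_p -> R) (x h : 'rV[R]_p) :
  differentiable f x -> 'D_h f x = \sum_(i < p) gradient f x ord0 i * h ord0 i.
Proof.
move=> df; rewrite deriveE// {1}[h]row_sum_delta linear_sum/=.
by apply: eq_bigr => i _; rewrite linearZ/= -deriveE// mxE mulrC.
Qed.

Lemma is_derive_line (R : realType) (p : nat) (f : 'rV[R]_p -> R) (x h : 'rV[R]_p) (a : R) :
  differentiable f (x + a *: h) ->
  is_derive a 1 (fun b : R => f (x + b *: h)) ('D_h f (x + a *: h)).
Proof.
move=> df; have := @diff_derivable _ _ _ f _ h df.
rewrite /derivable => dfh.
have E : (fun k : R => k^-1 *:
      (((fun b : R => f (x + b *: h)) \o shift a) (k *: 1) - f (x + a *: h))) =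
   (fun k : R => k^-1 *: ((f \o shift (x + a *: h)) (k *: h) - f (x + a *: h))).
  apply/funext => k /=; congr (_ *: (f _ - _)).
  by rewrite -[k *: 1]/(k * 1) mulr1 scalerDl addrCA.
by apply: DeriveDef; rewrite /derivable /derive E.
Qed.

(** Subtracting from [f] along the segment from [x] to [x + h] its linearization and
    the quadratic L |h|^2 a^2 / 2 leaves a function of [a] whose derivative is
    nonpositive, by Cauchy-Schwarz and the Lipschitz bound on the gradient. *)
Lemma descent_lemma (R : realType) (p : nat) (f : 'rV[R]_p -> R) (L : R) (x h : 'rV[R]_p) :
  (forall y, differentiable f y) -> lipschitz_gradient L f ->
  f (x + h) <= f x + \sum_(i < p) gradient f x ord0 i * h ord0 i + L / 2 * enorm h ^+ 2.
Proof.
move=> df lf; pose ip y := \sum_(i < p) gradient f y ord0 i * h ord0 i.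
pose phi (a : R) := f (x + a *: h) - a * ip x - L / 2 * enorm h ^+ 2 * a ^+ 2.
have dphi (a : R) : is_derive a 1 phi
    (ip (x + a *: h) - ip x - L * enorm h ^+ 2 * a).
  have := is_derive_line (df (x + a *: h)); rewrite derive_gradient// => dl.
  apply: is_derive_eq.
  by rewrite /GRing.scale/= -/(ip (x + a *: h)); field.
have cphi : {within `[0, 1], continuous phi}.
  apply: continuous_subspaceT => b.
  by apply/differentiable_continuous/derivable1_diffP; case: (dphi b).
have [c c01 E] := MVT ltr01 (fun c _ => dphi c) cphi.
have {E} : phi 1 - phi 0 <= 0.
  rewrite E subr0 mulr1 subr_le0.
  have -> : ip (x + c *: h) - ip x =
      \sum_(i < p) (gradient f (x + c *: h) - gradient f x) ord0 i * h ord0 i.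
    by rewrite -sumrB; apply: eq_bigr => i _; rewrite !mxE mulrBl.
  apply: le_trans (inner_le_enorm _ _) _.
  have c0 : 0 <= c by move: c01; rewrite in_itv/= => /andP[/ltW].
  have := lf (x + c *: h) x; rewrite addrAC subrr add0r enormZ ger0_norm// => H.
  apply: le_trans (ler_wpM2r (enorm_ge0 h) H) _.
  rewrite le_eqVlt; apply/orP; left; apply/eqP; ring.
rewrite /phi scale1r scale0r addr0 mul1r mul0r expr1n expr0n/= mulr0 !subr0 mulr1 -/(ip x).
by move=> H; lra.
Qed.

(** * Expected decrease of one probe *)

Definition decrease (R : realType) (p : nat) (f : 'rV[R]_p -> R) (a : R)
    (x v : 'rV[R]_p) : R := Num.max 0 (f x - f (x + a *: v)).

Lemma measurable_decrease (R : realType) (p : nat) (f : 'rV[R]_p -> R) (a : R) :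
  continuous f ->
  measurable_fun setT (fun xv : rV_borel R p * rV_borel R p => decrease f a xv.1 xv.2).
Proof.
move=> cf; apply: measurable_maxr => //; apply: measurable_funB.
  exact: (measurableT_comp (continuous_measurable_rV cf) measurable_fst).
apply: (measurableT_comp (continuous_measurable_rV cf)).
exact: (measurable_rV_addZ a measurable_fst measurable_snd).
Qed.

(** For one of the two probes [v] and [- v] the linear term of the descent lemma is
    negative, and already its decrease is at least the left-hand side minus the
    quadratic term; the other decrease is nonnegative. The quadratic term is
    thus paid once for two probes, which is the source of the constant L / 4
    instead of L / 2 in the theorem. *)
Lemma inner_le_decrease (R : realType) (p : nat) (f : 'rV[R]_p -> R) (L a : R)
    (x v : 'rV[R]_p) :
  (forall y, differentiable f y) -> lipschitz_gradient L f -> 0 <= a ->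
  a * `|\sum_(i < p) gradient f x ord0 i * v ord0 i| <=
  decrease f a x v + decrease f a x (- v) + L / 2 * a ^+ 2 * enorm v ^+ 2.
Proof.
move=> df lf a0; set g := gradient f x; set ip := \sum_(i < p) _.
have dec0 w : 0 <= decrease f a x w by rewrite le_max lexx.
have dec (w : 'rV[R]_p) : - (a * \sum_(i < p) g ord0 i * w ord0 i) <=
    decrease f a x w + L / 2 * a ^+ 2 * enorm w ^+ 2.
  have := descent_lemma x (a *: w) df lf.
  rewrite -/g enormZ ger0_norm// exprMn.
  rewrite (eq_bigr (fun i => a * (g ord0 i * w ord0 i))); last first.
    by move=> i _; rewrite [X in _ * X]mxE mulrCA.
  rewrite -mulr_sumr => H.
  have : f x - f (x + a *: w) <= decrease f a x w by rewrite le_max lexx orbT.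
  by move: H; lra.
have ipN : \sum_(i < p) g ord0 i * (- v) ord0 i = - ip.
  by rewrite -sumrN; apply: eq_bigr => i _; rewrite [X in _ * X]mxE mulrN.
have nN : enorm (- v) = enorm v by rewrite -scaleN1r enormZ normrN normr1 mul1r.
have [ip0|ip0] := leP 0 ip.
  have := dec (- v); rewrite ipN nN mulrN opprK.
  by have := dec0 v; rewrite ger0_norm//; lra.
by have := dec v; have := dec0 (- v); rewrite ltr0_norm// -/ip; lra.
Qed.

(** Integrating [inner_le_decrease] and using the symmetry of V: the left-hand side
    becomes a E|<g, V>|, where <g, V> is normal with deviation |g| / sqrt p,
    and on the right E|V|^2 <= 1. *)
Lemma expected_decrease d (Omega : measurableType d) (R : realType)
    (P : probability Omega R) (p : nat) (V : Omega -> 'rV[R]_p)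
    (f : 'rV[R]_p -> R) (L a : R) (x : 'rV[R]_p) :
  (1 <= p)%N -> 0 <= L -> 0 <= a ->
  isotropic_gaussian P (Num.sqrt p%:R^-1) V ->
  (forall y, differentiable f y) -> lipschitz_gradient L f ->
  (((Num.sqrt (2 * pi * p%:R))^-1 * (a * enorm (gradient f x)))%:E <=
   \int[P]_w (decrease f a x (V w))%:E + (L / 4 * a ^+ 2)%:E)%E.
Proof.
move=> p1 L0 a0 gV df lf; pose s : R := Num.sqrt p%:R^-1.
have p0 : 0 < p%:R :> R by rewrite ltr0n.
have s0 : 0 < s by rewrite sqrtr_gt0 invr_gt0.
have mV := isotropic_gaussian_measurable gV.
have cf : continuous f by move=> y; exact: differentiable_continuous.
pose g := gradient f x; pose ip (v : 'rV[R]_p) := \sum_(i < p) g ord0 i * v ord0 i.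
have mdec : measurable_fun setT (fun v : rV_borel R p => (decrease f a x v)%:E).
  apply/measurable_EFinP.
  have mx : measurable_fun setT (fun v : rV_borel R p => (x : rV_borel R p, v)).
    by apply: measurable_fun_pair.
  have mdecx := measurableT_comp (measurable_decrease a cf) mx.
  exact: mdecx.
have dec0 v : (0 <= (decrease f a x v)%:E)%E by rewrite lee_fin le_max lexx.
set I := (\int[P]_w (decrease f a x (V w))%:E)%E.
have IN : (\int[P]_w (decrease f a x (- V w))%:E)%E = I.
  by apply: (ge0_expectation_gaussian_opp _ gV mdec dec0); rewrite gt_eqF.
have abs_moment : (\int[P]_w (a * `|ip (V w)|)%:E =
    (2 * ((Num.sqrt (2 * pi * p%:R))^-1 * (a * enorm g)))%:E)%E.
  pose F (y : R) := (a * `|y|)%:E.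
  have mF : measurable_fun setT F.
    by apply/measurable_EFinP; apply: measurable_funM => //; exact: normr_measurable.
  have F0 y : (0 <= F y)%E by rewrite lee_fin mulr_ge0.
  rewrite [LHS](ge0_expectation_inner_gaussian g s0 gV mF F0).
  rewrite /F; under eq_integral do
    rewrite normrM (ger0_norm (enorm_ge0 g)) mulrA EFinM.
  rewrite ge0_integralZl//; last 2 first.
  - by apply/measurable_EFinP; exact: normr_measurable.
  - by rewrite lee_fin mulr_ge0// enorm_ge0.
  rewrite (gaussian_abs_moment s0) -EFinM; congr EFin.
  rewrite (sqrtrM p%:R) ?mulr_ge0 ?pi_ge0// invfM /s sqrtrV ?ltW//.
  by ring.
have second_moment : (\int[P]_w (enorm (V w) ^+ 2)%:E <= 1)%E.
  under eq_integral do rewrite enorm_sqr -sumEFin.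
  rewrite ge0_integral_sum//; last 2 first.
  - move=> i; apply/measurable_EFinP; apply: measurable_funX.
    exact: (measurableT_comp (measurable_coord i) mV).
  - by move=> i w _; rewrite lee_fin sqr_ge0.
  apply: (@le_trans _ _ (\sum_(i < p) (s ^+ 2)%:E)%E); last first.
    rewrite sumEFin lee_fin sumr_const card_ord sqr_sqrtr ?invr_ge0 ?ler0n//.
    by rewrite -[p%:R^-1 *+ p]mulr_natr mulVf ?gt_eqF.
  apply: lee_sum => i _.
  have mX2 : measurable_fun setT (fun y : R => (y ^+ 2)%:E).
    by apply/measurable_EFinP; exact: exprn_measurable.
  have X20 (y : R) : (0 <= (y ^+ 2)%:E)%E by rewrite lee_fin sqr_ge0.
  have := ge0_expectation_inner_gaussian (delta_mx ord0 i) s0 gV mX2 X20.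
  have -> : enorm (delta_mx ord0 i : 'rV[R]_p) = 1.
    rewrite /enorm (bigD1 i)//= big1 ?mxE ?eqxx/= ?expr1n ?addr0 ?sqrtr1// => j ji.
    by rewrite mxE eqxx (negbTE ji) expr0n.
  have coordE w : \sum_(j < p) (delta_mx ord0 i : 'rV[R]_p) ord0 j * V w ord0 j = V w ord0 i.
    rewrite (bigD1 i)//= big1 ?addr0 ?mxE ?eqxx ?mul1r// => j ji.
    by rewrite mxE eqxx (negbTE ji) mul0r.
  move=> E; rewrite (_ : (\int[P]_w _)%E = (\int[normal_prob 0 s]_z (z ^+ 2)%:E)%E).
    exact: gaussian_second_moment_le.
  transitivity (\int[normal_prob 0 s]_z ((1 * z) ^+ 2)%:E)%E.
    by rewrite -E; apply: eq_integral => w _; rewrite coordE.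
  by apply: eq_integral => z _; rewrite mul1r.
have mdecV : measurable_fun setT (fun w => (decrease f a x (V w))%:E).
  exact: (measurableT_comp mdec mV).
have mNV := measurable_rV_opp mV.
have mdecNV : measurable_fun setT (fun w => (decrease f a x (- V w))%:E).
  exact: (measurableT_comp mdec mNV).
have menorm2 : measurable_fun setT (fun w => (enorm (V w) ^+ 2)%:E).
  apply/measurable_EFinP; under eq_fun do rewrite enorm_sqr.
  apply: measurable_sum => i; apply: measurable_funX.
  exact: (measurableT_comp (measurable_coord i) mV).
have mip : measurable_fun setT (fun w => (a * `|ip (V w)|)%:E).
  apply/measurable_EFinP; apply: measurable_funM => //.
  apply: (measurableT_comp (@normr_measurable R setT)).
  apply: measurable_sum => i; apply: measurable_funM => //.
  exact: (measurableT_comp (measurable_coord i) mV).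
have La0 : 0 <= L / 2 * a ^+ 2 by rewrite mulr_ge0 ?divr_ge0// sqr_ge0.
have sum_ge : ((2 * ((Num.sqrt (2 * pi * p%:R))^-1 * (a * enorm g)))%:E <=
    I + I + (L / 2 * a ^+ 2)%:E)%E.
  rewrite -abs_moment.
  apply: (@le_trans _ _ (\int[P]_w ((decrease f a x (V w))%:E +
      (decrease f a x (- V w))%:E + (L / 2 * a ^+ 2)%:E * (enorm (V w) ^+ 2)%:E))%E).
    apply: ge0_le_integral => //.
    - by move=> w _; rewrite lee_fin mulr_ge0.
    - apply: emeasurable_funD; first exact: emeasurable_funD.
      exact: measurable_funeM.
    - move=> w _; rewrite -EFinM -!EFinD lee_fin.
      exact: inner_le_decrease.
  rewrite ge0_integralD//; last 4 first.
  - by move=> w _; rewrite adde_ge0.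
  - exact: emeasurable_funD.
  - by move=> w _; rewrite mule_ge0// lee_fin sqr_ge0.
  - exact: measurable_funeM.
  rewrite ge0_integralD// IN leeD2l// ge0_integralZl//; last first.
    by move=> w _; rewrite lee_fin sqr_ge0.
  by rewrite -[leRHS]mule1 lee_wpmul2l// lee_fin.
have I0 : (0 <= I)%E by apply: integral_ge0.
move: sum_ge I0; rewrite -/g; case: (I) => [r| |].
- by rewrite -!EFinD !lee_fin; lra.
- by move=> _ _; rewrite addye// leey.
- by move=> _; rewrite leeNy_eq => /eqP.
Qed.

(** * Telescoping along the search *)

Lemma continuous_enormB (R : realType) (p : nat) (x : 'rV[R]_p) :
  continuous (fun y : 'rV[R]_p => enorm (y - x)).
Proof.
move=> y; apply: (@continuous_comp _ _ _ (fun y : 'rV[R]_p => \sum_(i < p) (y - x) ord0 i ^+ 2)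
   (@Num.sqrt R)); last exact: sqrt_continuous.
move: y; apply: continuous_big => [|i _ y]; first exact: add_continuous.
apply: (@continuous_comp _ _ _ (fun y : 'rV[R]_p => (y - x) ord0 i) (fun r => r ^+ 2)).
  rewrite (_ : (fun _ => _) = (fun y : 'rV[R]_p => y ord0 i - x ord0 i)); last first.
    by apply/funext => z; rewrite !mxE.
  by apply: continuousB; [exact: coord_continuous|exact: cst_continuous].
exact: sqr_continuous.
Qed.

(** A Lipschitz gradient is continuous, coordinate by coordinate. *)
Lemma measurable_enorm_gradient (R : realType) (p : nat) (f : 'rV[R]_p -> R) (L : R) :
  lipschitz_gradient L f ->
  measurable_fun setT (fun x : rV_borel R p => enorm (gradient f x)).
Proof.
move=> lf.
have cg i : continuous (fun x => gradient f x ord0 i).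
  move=> x; have FF : Filter (nbhs x) by exact: nbhs_filter.
  apply/(cvgrPdist_le (FF := FF)) => e e0.
  have : L * enorm (y - x) @[y --> x] --> 0.
    rewrite -[X in _ --> X](mulr0 L) -[X in L * X](_ : enorm (x - x) = 0).
      exact: (cvgM (FF := FF) (cvg_cst L (FF := FF)) (@continuous_enormB R p x x)).
    by rewrite subrr /enorm big1 ?sqrtr0// => j _; rewrite mxE expr0n.
  move/(cvgr0_norm_le (FF := FF)) => /(_ e e0); apply: filterS => y /=.
  apply: le_trans; rewrite distrC; apply: le_trans (ler_norm _).
  apply: le_trans (lf y x).
  rewrite /enorm (bigD1 i)//= -sqrtr_sqr.
  apply: ler_wsqrtr; rewrite !mxE lerDl.
  by apply: sumr_ge0 => j _; exact: sqr_ge0.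
apply: (@measurableT_comp _ _ _ _ _ _ (@Num.sqrt R)).
  by apply: continuous_measurable_fun; exact: sqrt_continuous.
apply: measurable_sum => i; apply: measurable_funX.
exact: continuous_measurable_rV.
Qed.

Lemma sup_dist_le (R : realType) (p : nat) (f g : 'rV[R]_p -> R) (x : 'rV[R]_p) :
  sup_dist f g \is a fin_num -> `|f x - g x| <= fine (sup_dist f g).
Proof.
move=> fin; rewrite -lee_fin fineK//.
by apply: ereal_sup_ubound; exists x.
Qed.

(** The selected point has the smaller of the two oracle values, up to the time at
    which it was evaluated. Replacing oracle values by values of the objective
    costs one error before and one after the comparison, and moving between the
    times t, t+1 and t+2 costs drifts; each is counted at most twice. *)
Lemma search_step_decrease (R : realType) (p : nat) (Phi oracle : nat -> 'rV[R]_p -> R)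
    (drift err : nat -> R) (t : nat) (a : R) (x v x' : 'rV[R]_p) :
  (forall s y, `|Phi s.+1 y - Phi s y| <= drift s) ->
  (forall s y, `|oracle s y - Phi s y| <= err s) ->
  x' = (if oracle t.+1 (x + a *: v) <= oracle t x then x + a *: v else x) ->
  Phi t.+2 x' + decrease (Phi t) a x v <=
  Phi t x + 2 * (drift t + drift t.+1) + 2 * (err t + err t.+1).
Proof.
move=> dr er ->; rewrite /decrease; set y := x + a *: v.
have drP s z : Phi s.+1 z - Phi s z <= drift s /\ Phi s z - Phi s.+1 z <= drift s.
  by have := dr s z; rewrite ler_norml => /andP[]; split; lra.
have erP s z : oracle s z - Phi s z <= err s /\ Phi s z - oracle s z <= err s.
  by have := er s z; rewrite ler_norml => /andP[]; split; lra.
have d0 s : 0 <= drift s by apply: le_trans (dr s x).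
have e0 s : 0 <= err s by apply: le_trans (er s x).
have := drP t x; have := drP t.+1 x; have := drP t y; have := drP t.+1 y.
have := erP t x; have := erP t.+1 y; have := d0 t; have := d0 t.+1.
have := e0 t; have := e0 t.+1.
move=> ? ? ? ? [? ?] [? ?] [? ?] [? ?] [? ?] [? ?].
case: ifPn => [H|]; last rewrite -ltNge => H.
all: by case: (leP 0 (Phi t x - Phi t y)) => ?; lra.
Qed.

(** [expected_decrease] holds at every frozen point; independence lets the point be
    random. *)
Lemma expected_gradient_le d (Omega : measurableType d) (R : realType)
    (P : probability Omega R) (p : nat) (U V : Omega -> 'rV[R]_p)
    (f : 'rV[R]_p -> R) (L a : R) :
  (1 <= p)%N -> 0 <= L -> 0 <= a ->
  measurable_fun setT (U : Omega -> rV_borel R p) ->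
  isotropic_gaussian P (Num.sqrt p%:R^-1) V ->
  (forall A B, borel A -> borel B ->
    P (U @^-1` A `&` V @^-1` B) = P (U @^-1` A) * P (V @^-1` B))%E ->
  (forall y, differentiable f y) -> lipschitz_gradient L f ->
  (((Num.sqrt (2 * pi * p%:R))^-1 * a)%:E *
     \int[P]_w (enorm (gradient f (U w)))%:E <=
   \int[P]_w (decrease f a (U w) (V w))%:E + (L / 4 * a ^+ 2)%:E)%E.
Proof.
move=> p1 L0 a0 mU gV indep df lf; have mV := isotropic_gaussian_measurable gV.
have cf : continuous f by move=> y; exact: differentiable_continuous.
set c := (Num.sqrt _)^-1; have c0 : 0 <= c by rewrite invr_ge0 sqrtr_ge0.
pose F (xy : rV_borel R p * rV_borel R p) := (decrease f a xy.1 xy.2)%:E.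
have mF : measurable_fun setT F by apply/measurable_EFinP; exact: measurable_decrease.
have F0 xy : (0 <= F xy)%E by rewrite lee_fin le_max lexx.
have mg : measurable_fun setT (fun w => (enorm (gradient f (U w)))%:E).
  apply/measurable_EFinP.
  exact: (measurableT_comp (measurable_enorm_gradient lf) mU).
rewrite (ge0_expectation_indep mU mV indep mF F0).
have mInner : measurable_fun setT (fun w => \int[P]_w' F (U w, V w'))%E.
  have mFV : measurable_fun setT (fun xw : rV_borel R p * Omega => F (xw.1, V xw.2)).
    apply: (measurableT_comp mF); apply: measurable_fun_pair => //.
    exact: (measurableT_comp mV).
  have mFF := measurable_fun_fubini_tonelli_F (m2 := P) _ mFV (fun=> F0 _).
  exact: (measurableT_comp mFF mU).
have Inner0 w : (0 <= \int[P]_w' F (U w, V w'))%E by apply: integral_ge0.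
have const : (L / 4 * a ^+ 2)%:E = (\int[P]_w (L / 4 * a ^+ 2)%:E)%E.
  by rewrite probability_integral_cst.
have La0 : 0 <= L / 4 * a ^+ 2 by rewrite mulr_ge0 ?divr_ge0 ?sqr_ge0.
rewrite const -ge0_integralD// -ge0_integralZl//; last 2 first.
- by move=> w _; rewrite lee_fin enorm_ge0.
- by rewrite lee_fin mulr_ge0.
apply: ge0_le_integral => //.
- by move=> w _; rewrite -EFinM lee_fin !mulr_ge0 ?enorm_ge0.
- exact: measurable_funeM.
- exact: emeasurable_funD.
- move=> w _; have := expected_decrease (U w) p1 L0 a0 gV df lf.
  by rewrite -/c mulrA EFinM.
Qed.

Lemma sum_even_recr (V : nmodType) (F : nat -> V) (t : nat) : ~~ odd t ->
  \sum_(i < t.+2 | ~~ odd i) F i = \sum_(i < t | ~~ odd i) F i + F t.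
Proof.
move=> te; rewrite big_mkcond !big_ord_recr/= te/= addr0.
by congr (_ + _); rewrite [RHS]big_mkcond.
Qed.

(** The potential is the expected gap to the lower bound. It stays on the
    left-hand side, where it is nonnegative, so every integral involved is that
    of a nonnegative function and no integrability has to be established. *)
Lemma telescoped_expectation (R : realType) (p : nat) (p_ge1 : (1 <= p)%N)
    (Phi : nat -> 'rV[R]_p -> R) (L Philow : R)
    (L_ge0 : 0 <= L)
    (Phi_diff : forall t x, differentiable (Phi t) x)
    (Phi_smooth : forall t, lipschitz_gradient L (Phi t))
    (Phi_low : forall t x, Philow <= Phi t x)
    (oracle : nat -> 'rV[R]_p -> R)
    (oracle_cont : forall t, continuous (oracle t))
    (drift err : nat -> R)
    (driftP : forall t x, `|Phi t.+1 x - Phi t x| <= drift t)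
    (errP : forall t x, `|oracle t x - Phi t x| <= err t)
    (d : measure_display) (Omega : measurableType d) (P : probability Omega R)
    (u0 : 'rV[R]_p) (delta : nat -> R)
    (delta_ge0 : forall t, ~~ odd t -> 0 <= delta t)
    (v u : nat -> Omega -> 'rV[R]_p)
    (v_gauss : gaussian_directions P v)
    (u_search : two_point_direct_search oracle u0 delta v u) (k : nat) :
  (\int[P]_w (Phi k.*2 (u k.*2 w) - Philow)%:E +
   \sum_(t < k.*2 | ~~ odd t) ((Num.sqrt (2 * pi * p%:R))^-1 * delta t)%:E *
      \int[P]_w (enorm (gradient (Phi t) (u t w)))%:E <=
   (Phi 0%N u0 - Philow + L / 4 * (\sum_(t < k.*2 | ~~ odd t) delta t ^+ 2)
    + 2 * (\sum_(t < k.*2) drift t) + 2 * (\sum_(t < k.*2) err t))%:E)%E.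
Proof.
have cPhi t : continuous (Phi t) by move=> y; exact: differentiable_continuous.
have mv t : ~~ odd t -> measurable_fun setT (v t : Omega -> rV_borel R p).
  by move=> te; have [gv _] := v_gauss t te; exact: isotropic_gaussian_measurable gv.
have past_meas t B : past_draws v t B -> measurable B.
  apply: smallest_sub; first exact: sigma_algebra_measurable.
  move=> _ [s [A [_ se bA ->]]].
  by rewrite -[X in measurable X]setTI; exact: mv.
have mu t : ~~ odd t -> measurable_fun setT (u t : Omega -> rV_borel R p).
  move=> te _ A bA; rewrite setTI; apply: (past_meas t).
  exact: (search_iterate_past oracle_cont u_search te bA).
have indep t : ~~ odd t -> forall A B, borel A -> borel B ->
    (P (u t @^-1` A `&` v t @^-1` B) = P (u t @^-1` A) * P (v t @^-1` B))%E.
  move=> te A B bA bB; rewrite setIC muleC; have [_ vi] := v_gauss t te.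
  apply: vi => //; exact: (search_iterate_past oracle_cont u_search te bA).
have mPhi t s : ~~ odd t -> measurable_fun setT (fun w => (Phi s (u t w) - Philow)%:E).
  move=> te; apply/measurable_EFinP; apply: measurable_funB => //.
  exact: (measurableT_comp (continuous_measurable_rV (cPhi s)) (mu t te)).
have Phi0 t s w : (0 <= (Phi s (u t w) - Philow)%:E)%E by rewrite lee_fin subr_ge0.
elim: k => [|k IH].
  rewrite !big_ord0 !mulr0 !addr0 ?adde0.
  under eq_integral do rewrite (search_init u_search).
  by rewrite probability_integral_cst.
set t := k.*2 in IH *; have te : ~~ odd t by rewrite odd_double.
have tte : ~~ odd t.+2 by rewrite /= negbK.
rewrite doubleS -/t.
rewrite (sum_even_recr (fun i => ((Num.sqrt (2 * pi * p%:R))^-1 * delta i)%:E *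
  \int[P]_w (enorm (gradient (Phi i) (u i w)))%:E)%E te).
rewrite (sum_even_recr (fun i => delta i ^+ 2) te) !big_ord_recr/=.
set Sg := (\sum_(i < t | ~~ odd i) _ * _)%E in IH *.
set Sd2 := \sum_(i < t | ~~ odd i) _ in IH *.
set Sdr := \sum_(i < t) drift i in IH *. set Ser := \sum_(i < t) err i in IH *.
set G := (\int[P]_w (enorm (gradient (Phi t) (u t w)))%:E)%E.
set D := (\int[P]_w (decrease (Phi t) (delta t) (u t w) (v t w))%:E)%E.
have gle : (((Num.sqrt (2 * pi * p%:R))^-1 * delta t)%:E * G <=
    D + (L / 4 * delta t ^+ 2)%:E)%E.
  have [gv _] := v_gauss t te.
  exact: (expected_gradient_le p_ge1 L_ge0 (delta_ge0 t te) (mu t te) gv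
    (indep t te) (Phi_diff t) (Phi_smooth t)).
have step : (\int[P]_w (Phi t.+2 (u t.+2 w) - Philow)%:E + D <=
   \int[P]_w (Phi t (u t w) - Philow)%:E +
     (2 * (drift t + drift t.+1) + 2 * (err t + err t.+1))%:E)%E.
  have mD : measurable_fun setT
      (fun w => (decrease (Phi t) (delta t) (u t w) (v t w))%:E).
    apply/measurable_EFinP.
    have muv : measurable_fun setT (fun w => (u t w : rV_borel R p, v t w : rV_borel R p)).
      by apply: measurable_fun_pair; [exact: mu|exact: mv].
    exact: (measurableT_comp (measurable_decrease (delta t) (cPhi t)) muv).
  have D0 w : (0 <= (decrease (Phi t) (delta t) (u t w) (v t w))%:E)%E.
    by rewrite lee_fin le_max lexx.
  set C := 2 * _ + _.
  have C0 : 0 <= C.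
    have drift0 r : 0 <= drift r by apply: le_trans (driftP r 0).
    have err0 r : 0 <= err r by apply: le_trans (errP r 0).
    by rewrite addr_ge0// mulr_ge0// addr_ge0.
  rewrite -ge0_integralD//; [|exact: mPhi].
  have -> : C%:E = (\int[P]_w C%:E)%E by rewrite probability_integral_cst.
  rewrite -ge0_integralD//; [|exact: mPhi].
  apply: ge0_le_integral => //.
  - by move=> w _; exact: adde_ge0.
  - by apply: emeasurable_funD => //; exact: mPhi.
  - by apply: emeasurable_funD => //; exact: mPhi.
  move=> w _; rewrite -!EFinD lee_fin.
  have := @search_step_decrease _ _ Phi oracle drift err t (delta t)
    (u t w) (v t w) (u t.+2 w) driftP errP.
  rewrite (search_select u_search)// (search_probe u_search)// => /(_ erefl).
  by rewrite /C; lra.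
(* Bound the new gradient term by the expected decrease, absorb the latter in
   the decay of the potential, then use the induction hypothesis. *)
apply: (le_trans (leeD2l _ (leeD2l _ gle))).
rewrite addeCA [X in (_ + X <= _)%E]addeA.
apply: (le_trans (leeD2l _ (leeD2r _ step))).
rewrite -[X in (_ + X <= _)%E]addeA addeA [X in (X + _ <= _)%E]addeC.
apply: (le_trans (leeD2r _ IH)).
by rewrite -!EFinD lee_fin; lra.
Qed.

Theorem theorem3p1 (R : realType) (p : nat) (p_ge1 : (1 <= p)%N)
    (Phi : nat -> 'rV[R]_p -> R) (L Philow : R)
    (L_gt0 : 0 < L)
    (Phi_diff : forall t x, differentiable (Phi t) x)
    (Phi_smooth : forall t, lipschitz_gradient L (Phi t))
    (Phi_low : forall t x, Philow <= Phi t x)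
    (oracle : nat -> 'rV[R]_p -> R)
    (oracle_cont : forall t, continuous (oracle t))
    (drift_fin : forall t, sup_dist (Phi t.+1) (Phi t) \is a fin_num)
    (error_fin : forall t, sup_dist (oracle t) (Phi t) \is a fin_num)
    (d : measure_display) (Omega : measurableType d) (P : probability Omega R)
    (u0 : 'rV[R]_p) (delta : nat -> R)
    (delta_gt0 : forall t, ~~ odd t -> 0 < delta t)
    (v u : nat -> Omega -> 'rV[R]_p)
    (v_gauss : gaussian_directions P v)
    (u_search : two_point_direct_search oracle u0 delta v u)
    (T : nat) (T_even : ~~ odd T) (T_ge2 : (2 <= T)%N) :
  let D := (\sum_(t < T) sup_dist (Phi t.+1) (Phi t))%E in
  let B := (\sum_(t < T) sup_dist (oracle t) (Phi t))%E in
  let grad_mean t := ('E_P[fun w => enorm (gradient (Phi t) (u t w))])%E in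
  let bound :=
    ((Phi 0%N u0 - Philow + L / 4 * \sum_(t < T | ~~ odd t) delta t ^+ 2)%:E
     + 2%:E * D + 2%:E * B)%E in
  ((Num.sqrt (2 * pi * p%:R))^-1%:E *
     \sum_(t < T | ~~ odd t) (delta t)%:E * grad_mean t <= bound)%E
  /\
  (\big[mine/+oo]_(t < T | ~~ odd t) grad_mean t <=
     (Num.sqrt (2 * pi * p%:R) / \sum_(t < T | ~~ odd t) delta t)%R%:E
       * bound)%E.
Proof.
move=> D B grad_mean bound.
pose drift t := fine (sup_dist (Phi t.+1) (Phi t)).
pose err t := fine (sup_dist (oracle t) (Phi t)).
have DE : D = (\sum_(t < T) drift t)%:E.
  by rewrite /D -sumEFin; apply: eq_bigr => t _; rewrite fineK.
have BE : B = (\sum_(t < T) err t)%:E.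
  by rewrite /B -sumEFin; apply: eq_bigr => t _; rewrite fineK.
have gradE t : grad_mean t = (\int[P]_w (enorm (gradient (Phi t) (u t w)))%:E)%E.
  by rewrite /grad_mean unlock.
have grad0 t : (0 <= grad_mean t)%E.
  by rewrite gradE; apply: integral_ge0 => w _; rewrite lee_fin enorm_ge0.
have delta_ge0 t : ~~ odd t -> 0 <= delta t by move=> /delta_gt0/ltW.
set c := Num.sqrt (2 * pi * p%:R).
have c0 : 0 < c by rewrite sqrtr_gt0 !mulr_gt0 ?pi_gt0 ?ltr0n.
have weighted0 (t : 'I_T) : ~~ odd t -> (0 <= (delta t)%:E * grad_mean t)%E.
  by move=> te; rewrite mule_ge0// lee_fin delta_ge0.
have part1 : (c^-1%:E * \sum_(t < T | ~~ odd t) (delta t)%:E * grad_mean t <= bound)%E.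
  have := @telescoped_expectation R p p_ge1 Phi L Philow (ltW L_gt0) Phi_diff
    Phi_smooth Phi_low oracle oracle_cont drift err
    (fun t x => sup_dist_le x (drift_fin t)) (fun t x => sup_dist_le x (error_fin t))
    d Omega P u0 delta delta_ge0 v u v_gauss u_search T./2.
  rewrite (even_halfK T_even) -/c => H.
  rewrite ge0_sume_distrr//.
  apply: (@le_trans _ _ _ _ _ (le_trans _ H)).
    rewrite -[leLHS]add0e; apply: leeD.
      by apply: integral_ge0 => w _; rewrite lee_fin subr_ge0.
    rewrite le_eqVlt; apply/orP; left; apply/eqP.
    by apply: eq_bigr => t _; rewrite EFinM muleA gradE.
  by rewrite /bound DE BE -!EFinM -!EFinD.
split => //.
set m := (\big[mine/+oo]_(t < T | ~~ odd t) grad_mean t)%E.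
set S := \sum_(t < T | ~~ odd t) delta t.
have S0 : 0 < S.
  rewrite /S (bigD1 (Ordinal (leq_trans (ltn0Sn 1) T_ge2)))//= ltr_pwDl ?delta_gt0//.
  by apply: sumr_ge0 => t /andP[te _]; exact: delta_ge0.
(* The minimum is at most the average with weights [delta t]. *)
have m_le (t : 'I_T) : ~~ odd t -> (m <= grad_mean t)%E.
  by move=> te; apply: bigmin_le_cond.
have m0 : (0 <= m)%E.
  by apply: le_bigmin => //; rewrite ?leey.
have Sm : (S%:E * m <= \sum_(t < T | ~~ odd t) (delta t)%:E * grad_mean t)%E.
  rewrite -sumEFin ge0_sume_distrl.
    by apply: lee_sum => t te; rewrite lee_wpmul2l ?lee_fin ?delta_ge0// m_le.
  by move=> t te; rewrite lee_fin delta_ge0.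
rewrite mulrC EFinM -muleA lee_pdivlMl//; apply: (le_trans Sm).
by rewrite -lee_pdivrMl.
Qed.
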